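(* Let $(\mathcal{F},\partial,\oint)$ be an ordinary differential Rota-Baxter algebra of weight $\lambda$ over $\mathbf{k}$, and let $(\tilde{\mathcal{F}},\partial,\int)$ be the free integro-differential algebra $\tilde{\mathcal{F}}=\mathcal{F}\otimes_K\mathcal{F}$ over it (where $K=\ker\partial=\mathbf{k}$). Then the assignment $$f\partial^k\mapsto f\partial^k,\qquad f\oint\tilde f\mapsto f\int\tilde f,\qquad f\oint\tilde f\,\partial^k\mapsto f\int\tilde f\,\partial^k\qquad(f,\tilde f\in\mathcal{F})$$ with $k\ge0$ in the first and $k>0$ in the third case, where on the right-hand sides $f\in\mathcal{F}$ is identified with $f\otimes1\in\tilde{\mathcal{F}}$, defines a $\mathbf{k}$-algebra monomorphism $\psi\colon\mathcal{F}[\partial,\oint]\to\tilde{\mathcal{F}}[\partial,\int]$ from the ring of differential Rota-Baxter operators over $\mathcal{F}$ to the ring of integro-differential operators over $\tilde{\mathcal{F}}$.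
   Context: $\mathbf{k}$ is a commutative ring and $\lambda\in\mathbf{k}$; coefficient algebras are commutative unital $\mathbf{k}$-algebras and operators are $\mathbf{k}$-linear. Write $f'=\partial f$. Laws (for all $f,g$): - Differential Rota-Baxter algebra of weight $\lambda$ $(\mathcal{F},\partial,\oint)$: $\partial(fg)=f'g+fg'+\lambda f'g'$; $(\oint f)(\oint g)=\oint(f\oint g)+\oint(g\oint f)+\lambda\oint(fg)$; $\partial\oint f=f$. It is ordinary if $\ker\partial=\mathbf{k}$. - Integro-differential algebra of weight $\lambda$: $\partial(fg)=f'g+fg'+\lambda f'g'$; $f\int g=\int(f'\int g)+\int(fg)+\lambda\int(f'g)$; $\partial\int f=f$. The free integro-differential algebra over $(\mathcal{F},\partial,\oint)$ is $\tilde{\mathcal{F}}=\mathcal{F}\otimes_K\mathcal{F}$, $K=\ker\partial$, with $\partial(f\otimes f_\epsilon)=(\partial f)\otimes f_\epsilon$ and $\int(f\otimes f_\epsilon)=(\oint f)\otimes f_\epsilon-1\otimes(f_\epsilon\oint f)$; it is an integro-differential algebra of weight $\lambda$. Operator rings. For a set $\Omega$ of symbols, $\mathcal{F}*\mathbf{k}\langle\Omega\rangle$ is the free product of $\mathbf{k}$-algebras. - $\mathcal{F}[\partial,\oint]$ is the quotient of $\mathcal{F}*\mathbf{k}\langle\partial,\oint\rangle$ by the two-sided ideal generated by, for all $f\in\mathcal{F}$, $\partial f-f\partial-\lambda f'\partial-f'$, $\ \oint f\oint-f^{\backprime}\oint+\oint f^{\backprime}+\lambda\oint f$ and $\partial\oint-1$,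 where $f^{\backprime}\in\mathcal{F}$ is the value of the integral of $\mathcal{F}$ at $f$. As a $\mathbf{k}$-module it is the direct sum of the submodules spanned by the elements $f\partial^k$ ($k\ge0$), $f\oint\tilde f$, and $f\oint\tilde f\partial^k$ ($k>0$), respectively ($f,\tilde f\in\mathcal{F}$). - For an integro-differential algebra $(\tilde{\mathcal{F}},\partial,\int)$, $\tilde{\mathcal{F}}[\partial,\int]$ is the quotient of $\tilde{\mathcal{F}}*\mathbf{k}\langle\partial,\int\rangle$ by the two-sided ideal generated by, for all $f\in\tilde{\mathcal{F}}$, $\partial f-f\partial-\lambda f'\partial-f'$, $\ \partial\int-1$ and $\int(f+\lambda f')\partial-f+\int f'+\mathbf{e}(f)\,\mathbf{e}$, where $\mathbf{e}=1-\int\partial$ as an operator and $\mathbf{e}(f)=f-\int f'\in\tilde{\mathcal{F}}$ is the value of the evaluation at $f$. In relators, juxtaposition is the product in the free product. *)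

(* Defs.v *)
From HB Require Import structures.
From mathcomp Require Import all_boot all_order all_algebra.
From mathcomp Require Import boolp.

Set Implicit Arguments.
Unset Strict Implicit.
Unset Printing Implicit Defensive.

Import GRing.Theory.
Local Open Scope ring_scope.
Local Open Scope quotient_scope.

Section Laws.
Variables (k : comNzRingType) (lam : k) (A : comAlgType k).
Implicit Types (d J : A -> A).

Definition weight_derivation d := forall f g : A,
  d (f * g) = d f * g + f * d g + lam *: (d f * d g).

Definition differential_Rota_Baxter d J :=
  [/\ weight_derivation d,
      forall f g : A,
        J f * J g = J (f * J g) + J (g * J f) + lam *: J (f * g)
    & forall f : A, d (J f) = f].

Definition integro_differential d J :=
  [/\ weight_derivation d,
      forall f g : A,
        f * J g = J (d f * J g) + J (f * g) + lam *: J (d f * g)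
    & forall f : A, d (J f) = f].

(* ker d = k, where k is identified with its image k *: 1 in A. *)
Definition ordinary d :=
  forall f : A, d f = 0 <-> exists c : k, f = c *: 1.

End Laws.

(* The free product A * k<Om> of k-algebras, as the algebra generated by the
   elements of A and the symbols in Om, modulo the k-algebra axioms and the
   operations of A. Zero, one, opposites and scalars are taken from A. *)
Section FreeProduct.
Variables (k : comNzRingType) (A : algType k) (Om : Type).

Inductive fpexpr :=
  | FpCoef of A
  | FpSym of Om
  | FpAdd of fpexpr & fpexpr
  | FpMul of fpexpr & fpexpr.

HB.instance Definition _ := gen_eqMixin fpexpr.
HB.instance Definition _ := gen_choiceMixin fpexpr.

Local Notation "[ 'C' a ]" := (FpCoef a) (format "[ 'C'  a ]").
Local Infix "+!" := FpAdd (at level 50, left associativity).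
Local Infix "*!" := FpMul (at level 40, left associativity).
Local Reserved Notation "x =! y" (at level 70, no associativity).

Inductive fpeq : fpexpr -> fpexpr -> Prop :=
  | fp_refl x : x =! x
  | fp_sym x y : x =! y -> y =! x
  | fp_trans x y z : x =! y -> y =! z -> x =! z
  | fp_congD x x' y y' : x =! x' -> y =! y' -> x +! y =! x' +! y'
  | fp_congM x x' y y' : x =! x' -> y =! y' -> x *! y =! x' *! y'
  | fp_addA x y z : x +! (y +! z) =! x +! y +! z
  | fp_addC x y : x +! y =! y +! x
  | fp_add0 x : [C 0] +! x =! x
  | fp_addN x : [C -1] *! x +! x =! [C 0]
  | fp_mulA x y z : x *! (y *! z) =! x *! y *! z
  | fp_mul1l x : [C 1] *! x =! x
  | fp_mul1r x : x *! [C 1] =! x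
  | fp_mulDl x y z : (x +! y) *! z =! x *! z +! y *! z
  | fp_mulDr x y z : x *! (y +! z) =! x *! y +! x *! z
  | fp_central (c : k) x : [C c *: 1] *! x =! x *! [C c *: 1]
  | fp_coefD a b : [C a + b] =! [C a] +! [C b]
  | fp_coefM a b : [C a * b] =! [C a] *! [C b]
where "x =! y" := (fpeq x y).

Definition fpeqb (x y : fpexpr) : bool := `[< fpeq x y >].

Lemma fpeqb_refl : reflexive fpeqb.
Proof. by move=> x; apply/asboolP; apply: fp_refl. Qed.
Lemma fpeqb_sym : symmetric fpeqb.
Proof. by move=> x y; apply/asboolP/asboolP; apply: fp_sym. Qed.
Lemma fpeqb_trans : transitive fpeqb.
Proof.
by move=> y x z /asboolP h /asboolP h'; apply/asboolP; apply: fp_trans h h'.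
Qed.
Canonical fp_equiv := EquivRel fpeqb fpeqb_refl fpeqb_sym fpeqb_trans.

Definition freeProd := {eq_quot fpeqb}.
HB.instance Definition _ := Choice.on freeProd.
HB.instance Definition _ := EqQuotient.on freeProd.

Definition fp (x : fpexpr) : freeProd := \pi_freeProd x.

Lemma fp_eq x y : fp x = fp y <-> fpeq x y.
Proof. by split=> [/eqmodP /asboolP|/asboolP h]; last apply/eqmodP. Qed.

Lemma fpK (x : freeProd) : fp (repr x) = x.
Proof. exact: reprK. Qed.

Lemma fp_repr x : fpeq (repr (fp x)) x.
Proof. by apply/fp_eq; rewrite fpK. Qed.

Definition fp_add (x y : freeProd) := fp (repr x +! repr y).
Definition fp_mul (x y : freeProd) := fp (repr x *! repr y).
Definition fp_opp (x : freeProd) := fp ([C -1] *! repr x).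
Definition fp_scale (c : k) (x : freeProd) := fp ([C c *: 1] *! repr x).

Lemma fp_addE x y : fp_add (fp x) (fp y) = fp (x +! y).
Proof. by apply/fp_eq/fp_congD; apply: fp_repr. Qed.
Lemma fp_mulE x y : fp_mul (fp x) (fp y) = fp (x *! y).
Proof. by apply/fp_eq/fp_congM; apply: fp_repr. Qed.
Lemma fp_oppE x : fp_opp (fp x) = fp ([C -1] *! x).
Proof. by apply/fp_eq/fp_congM; [apply: fp_refl|apply: fp_repr]. Qed.
Lemma fp_scaleE c x : fp_scale c (fp x) = fp ([C c *: 1] *! x).
Proof. by apply/fp_eq/fp_congM; [apply: fp_refl|apply: fp_repr]. Qed.

Let fpE := (fp_addE, fp_oppE, fp_mulE, fp_scaleE).
Let fpP (P : freeProd -> Prop) : (forall x, P (fp x)) -> forall x, P x.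
Proof. by move=> h x; rewrite -[x]fpK. Qed.

Fact fp_qaddA : associative fp_add.
Proof. by do 3!elim/fpP=> ?; rewrite !fpE; apply/fp_eq/fp_addA. Qed.
Fact fp_qaddC : commutative fp_add.
Proof. by do 2!elim/fpP=> ?; rewrite !fpE; apply/fp_eq/fp_addC. Qed.
Fact fp_qadd0 : left_id (fp [C 0]) fp_add.
Proof. by elim/fpP=> ?; rewrite !fpE; apply/fp_eq/fp_add0. Qed.
Fact fp_qaddN : left_inverse (fp [C 0]) fp_opp fp_add.
Proof. by elim/fpP=> ?; rewrite !fpE; apply/fp_eq/fp_addN. Qed.
HB.instance Definition _ := GRing.isZmodule.Build freeProd
  fp_qaddA fp_qaddC fp_qadd0 fp_qaddN.

Fact fp_qmulA : associative fp_mul.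
Proof. by do 3!elim/fpP=> ?; rewrite !fpE; apply/fp_eq/fp_mulA. Qed.
Fact fp_qmul1l : left_id (fp [C 1]) fp_mul.
Proof. by elim/fpP=> ?; rewrite !fpE; apply/fp_eq/fp_mul1l. Qed.
Fact fp_qmul1r : right_id (fp [C 1]) fp_mul.
Proof. by elim/fpP=> ?; rewrite !fpE; apply/fp_eq/fp_mul1r. Qed.
Fact fp_qmulDl : left_distributive fp_mul fp_add.
Proof. by do 3!elim/fpP=> ?; rewrite !fpE; apply/fp_eq/fp_mulDl. Qed.
Fact fp_qmulDr : right_distributive fp_mul fp_add.
Proof. by do 3!elim/fpP=> ?; rewrite !fpE; apply/fp_eq/fp_mulDr. Qed.
HB.instance Definition _ := GRing.Zmodule_isPzRing.Build freeProd
  fp_qmulA fp_qmul1l fp_qmul1r fp_qmulDl fp_qmulDr.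

Definition fpcoef (a : A) : freeProd := fp [C a].
Definition fpsym (o : Om) : freeProd := fp (FpSym o).

Lemma fpcoef1 : fpcoef 1 = 1.
Proof. by []. Qed.
Lemma fpcoefD a b : fpcoef (a + b) = fpcoef a + fpcoef b.
Proof. by rewrite [RHS]fp_addE; apply/fp_eq/fp_coefD. Qed.
Lemma fpcoefM a b : fpcoef (a * b) = fpcoef a * fpcoef b.
Proof. by rewrite [RHS]fp_mulE; apply/fp_eq/fp_coefM. Qed.
Lemma fpscaleE c x : fp_scale c x = fpcoef (c *: 1) * x.
Proof. by elim/fpP: x => x; rewrite fpE [RHS]fpE. Qed.
Lemma fpcoef_central (c : k) x : fpcoef (c *: 1) * x = x * fpcoef (c *: 1).
Proof.
by elim/fpP: x => x; rewrite [LHS]fpE [RHS]fpE; apply/fp_eq/fp_central.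
Qed.

Fact fp_qscaleA a b x : fp_scale a (fp_scale b x) = fp_scale (a * b) x.
Proof.
by rewrite !fpscaleE mulrA -fpcoefM -scalerAl mul1r scalerA.
Qed.
Fact fp_qscale1 : left_id 1 fp_scale.
Proof. by move=> x; rewrite fpscaleE scale1r fpcoef1 mul1r. Qed.
Fact fp_qscaleDr : right_distributive fp_scale +%R.
Proof. by move=> c x y; rewrite !fpscaleE mulrDr. Qed.
Fact fp_qscaleDl x : {morph fp_scale^~ x : a b / a + b}.
Proof. by move=> a b; rewrite !fpscaleE scalerDl fpcoefD mulrDl. Qed.
HB.instance Definition _ := GRing.Zmodule_isLmodule.Build k freeProd
  fp_qscaleA fp_qscale1 fp_qscaleDr fp_qscaleDl.

Fact fp_scaleAl (c : k) (x y : freeProd) : c *: (x * y) = (c *: x) * y.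
Proof. by rewrite /GRing.scale /= !fpscaleE mulrA. Qed.
Fact fp_scaleAr (c : k) (x y : freeProd) : c *: (x * y) = x * (c *: y).
Proof. by rewrite /GRing.scale /= !fpscaleE !mulrA fpcoef_central. Qed.

Fact fpcoef_linear : linear fpcoef.
Proof.
move=> c a b; rewrite fpcoefD [c *: fpcoef a]/GRing.scale /= fpscaleE.
by rewrite -fpcoefM -scalerAl mul1r.
Qed.
HB.instance Definition _ := GRing.isLinear.Build k A freeProd *:%R fpcoef
  fpcoef_linear.
Fact fpcoef_monoid_morphism : monoid_morphism fpcoef.
Proof. by split=> //; apply: fpcoefM. Qed.
HB.instance Definition _ := GRing.isMonoidMorphism.Build A freeProd fpcoef
  fpcoef_monoid_morphism.

Lemma freeProd_ind (P : freeProd -> Prop) :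
  (forall a, P (fpcoef a)) -> (forall o, P (fpsym o)) ->
  (forall x y, P x -> P y -> P (x + y)) ->
  (forall x y, P x -> P y -> P (x * y)) -> forall x, P x.
Proof.
move=> hC hS hD hM; elim/fpP; elim=> [a|o|x hx y hy|x hx y hy].
- exact: hC.
- exact: hS.
- by have := hD _ _ hx hy; rewrite [_ + _]fpE.
- by have := hM _ _ hx hy; rewrite [_ * _]fpE.
Qed.

Section Universal.
Variables (B : pzRingType) (h : {rmorphism A -> B}) (s : Om -> B).
Hypothesis hs : forall (c : k) o, h (c *: 1) * s o = s o * h (c *: 1).

Fixpoint fpeval (x : fpexpr) : B :=
  match x with
  | FpCoef a => h a
  | FpSym o => s o
  | x +! y => fpeval x + fpeval y
  | x *! y => fpeval x * fpeval y
  end.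

Lemma fpeval_eq x y : fpeq x y -> fpeval x = fpeval y.
Proof.
elim=> /=; rewrite ?rmorph0 ?rmorph1 //.
- by move=> ? ? ? _ -> _ ->.
- by move=> ? ? ? ? _ -> _ ->.
- by move=> ? ? ? ? _ -> _ ->.
- by move=> *; rewrite addrA.
- by move=> *; rewrite addrC.
- by move=> *; rewrite add0r.
- by move=> *; rewrite rmorphN1 mulN1r addNr.
- by move=> *; rewrite mulrA.
- by move=> *; rewrite mul1r.
- by move=> *; rewrite mulr1.
- by move=> *; rewrite mulrDl.
- by move=> *; rewrite mulrDr.
- move=> c; elim=> [a|o|x0 hx y0 hy|x0 hx y0 hy] /=.
  + by rewrite -!rmorphM -scalerAl -scalerAr mul1r mulr1.
  + exact: hs.
  + by rewrite mulrDl mulrDr hx hy.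
  + by rewrite mulrA hx -mulrA hy mulrA.
- by move=> *; rewrite rmorphD.
- by move=> *; rewrite rmorphM.
Qed.

Lemma freeProd_universal : exists phi : {rmorphism freeProd -> B},
  (forall a, phi (fpcoef a) = h a) /\ (forall o, phi (fpsym o) = s o).
Proof.
pose phi (x : freeProd) := fpeval (repr x).
have phiE x : phi (fp x) = fpeval x by apply/fpeval_eq/fp_repr.
have phiD : {morph phi : x y / x + y}.
  by do 2!elim/fpP=> ?; rewrite [_ + _]fpE !phiE.
have phi0 : phi 0 = 0 by rewrite phiE /= rmorph0.
have phiM : monoid_morphism phi.
  split; first by rewrite phiE /= rmorph1.
  by do 2!elim/fpP=> ?; rewrite [_ * _]fpE !phiE.
pose LD := GRing.isNmodMorphism.Build freeProd B phi (phi0, phiD).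
pose LM := GRing.isMonoidMorphism.Build freeProd B phi phiM.
exists (HB.pack_for {rmorphism freeProd -> B} phi LD LM).
by split=> [a|o]; apply: phiE.
Qed.

End Universal.
End FreeProduct.

(* The quotient of the free product by the two-sided ideal generated by a set
   of relators. It carries pzRingType and lmodType structures rather than an
   algType one, because algType requires 1 != 0. *)
Section IdealQuotient.
Variables (k : comNzRingType) (A : algType k) (Om : Type).
Variable S : freeProd A Om -> Prop.
Local Notation T := (freeProd A Om).

Inductive ideal_gen : T -> Prop :=
  | ideal_rel x : S x -> ideal_gen x
  | ideal0 : ideal_gen 0
  | idealD x y : ideal_gen x -> ideal_gen y -> ideal_gen (x + y)
  | idealM a x b : ideal_gen x -> ideal_gen (a * x * b).

Definition ideal_eqb (x y : T) : bool := `[< ideal_gen (x - y) >].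

Lemma idealMl a x : ideal_gen x -> ideal_gen (a * x).
Proof. by move=> h; rewrite -[_ * _]mulr1; apply: idealM. Qed.

Lemma idealMr x b : ideal_gen x -> ideal_gen (x * b).
Proof. by move=> h; rewrite -[x]mul1r; apply: idealM. Qed.

Lemma idealN x : ideal_gen x -> ideal_gen (- x).
Proof. by move=> /(idealMl (-1)); rewrite mulN1r. Qed.

Lemma idealZ (c : k) x : ideal_gen x -> ideal_gen (c *: x).
Proof. by move=> /(idealMl (c *: (1 : T))); rewrite -fp_scaleAl mul1r. Qed.

Lemma ideal_eqb_refl : reflexive ideal_eqb.
Proof. by move=> x; apply/asboolP; rewrite subrr; apply: ideal0. Qed.

Lemma ideal_eqb_sym : symmetric ideal_eqb.
Proof.
by move=> x y; apply/asboolP/asboolP => /idealN; rewrite opprB.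
Qed.

Lemma ideal_eqb_trans : transitive ideal_eqb.
Proof.
move=> y x z /asboolP h1 /asboolP h2; apply/asboolP.
by have := idealD h1 h2; rewrite addrA subrK.
Qed.

Canonical ideal_equiv :=
  EquivRel ideal_eqb ideal_eqb_refl ideal_eqb_sym ideal_eqb_trans.

Definition quotAlg := {eq_quot ideal_eqb}.
HB.instance Definition _ := Choice.on quotAlg.
HB.instance Definition _ := EqQuotient.on quotAlg.

Definition toQuot (x : T) : quotAlg := \pi_quotAlg x.

Lemma toQuot_eq x y : toQuot x = toQuot y <-> ideal_gen (x - y).
Proof. by split=> [/eqmodP /asboolP|/asboolP h]; last apply/eqmodP. Qed.

Lemma reprKQ (x : quotAlg) : toQuot (repr x) = x.
Proof. exact: reprK. Qed.

Lemma repr_ideal x : ideal_gen (repr (toQuot x) - x).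
Proof. by apply/toQuot_eq; rewrite reprKQ. Qed.

Definition quot_add (x y : quotAlg) := toQuot (repr x + repr y).
Definition quot_opp (x : quotAlg) := toQuot (- repr x).
Definition quot_mul (x y : quotAlg) := toQuot (repr x * repr y).
Definition quot_scale (c : k) (x : quotAlg) := toQuot (c *: repr x).

Lemma quot_addE x y : quot_add (toQuot x) (toQuot y) = toQuot (x + y).
Proof.
apply/toQuot_eq; rewrite opprD addrACA.
by apply: idealD; apply: repr_ideal.
Qed.

Lemma quot_oppE x : quot_opp (toQuot x) = toQuot (- x).
Proof. by apply/toQuot_eq; rewrite -opprD; apply/idealN/repr_ideal. Qed.

Lemma quot_mulE x y : quot_mul (toQuot x) (toQuot y) = toQuot (x * y).
Proof.
apply/toQuot_eq; set x' := repr _; set y' := repr _.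
have -> : x' * y' - x * y = x' * (y' - y) + (x' - x) * y.
  by rewrite mulrBr mulrBl addrA subrK.
by apply: idealD; [apply/idealMl|apply/idealMr]; apply: repr_ideal.
Qed.

Lemma quot_scaleE c x : quot_scale c (toQuot x) = toQuot (c *: x).
Proof. by apply/toQuot_eq; rewrite -scalerBr; apply/idealZ/repr_ideal. Qed.

Let quotE := (quot_addE, quot_oppE, quot_mulE, quot_scaleE).
Let quotP (P : quotAlg -> Prop) : (forall x, P (toQuot x)) -> forall x, P x.
Proof. by move=> h x; rewrite -[x]reprKQ. Qed.

Fact quot_addA : associative quot_add.
Proof. by do 3!elim/quotP=> ?; rewrite !quotE addrA. Qed.
Fact quot_addC : commutative quot_add.
Proof. by do 2!elim/quotP=> ?; rewrite !quotE addrC. Qed.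
Fact quot_add0 : left_id (toQuot 0) quot_add.
Proof. by elim/quotP=> ?; rewrite !quotE add0r. Qed.
Fact quot_addN : left_inverse (toQuot 0) quot_opp quot_add.
Proof. by elim/quotP=> ?; rewrite !quotE addNr. Qed.
HB.instance Definition _ := GRing.isZmodule.Build quotAlg
  quot_addA quot_addC quot_add0 quot_addN.

Fact quot_mulA : associative quot_mul.
Proof. by do 3!elim/quotP=> ?; rewrite !quotE mulrA. Qed.
Fact quot_mul1l : left_id (toQuot 1) quot_mul.
Proof. by elim/quotP=> ?; rewrite !quotE mul1r. Qed.
Fact quot_mul1r : right_id (toQuot 1) quot_mul.
Proof. by elim/quotP=> ?; rewrite !quotE mulr1. Qed.
Fact quot_mulDl : left_distributive quot_mul quot_add.
Proof. by do 3!elim/quotP=> ?; rewrite !quotE mulrDl. Qed.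
Fact quot_mulDr : right_distributive quot_mul quot_add.
Proof. by do 3!elim/quotP=> ?; rewrite !quotE mulrDr. Qed.
HB.instance Definition _ := GRing.Zmodule_isPzRing.Build quotAlg
  quot_mulA quot_mul1l quot_mul1r quot_mulDl quot_mulDr.

Fact quot_scaleA a b x : quot_scale a (quot_scale b x) = quot_scale (a * b) x.
Proof. by elim/quotP: x => ?; rewrite !quotE scalerA. Qed.
Fact quot_scale1 : left_id 1 quot_scale.
Proof. by elim/quotP=> ?; rewrite !quotE scale1r. Qed.
Fact quot_scaleDr : right_distributive quot_scale +%R.
Proof.
by move=> c; do 2!elim/quotP=> ?; rewrite /GRing.add /= !quotE scalerDr.
Qed.
Fact quot_scaleDl x : {morph quot_scale^~ x : a b / a + b}.
Proof.
by elim/quotP: x => ? a b; rewrite [RHS]/GRing.add /= !quotE scalerDl.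
Qed.
HB.instance Definition _ := GRing.Zmodule_isLmodule.Build k quotAlg
  quot_scaleA quot_scale1 quot_scaleDr quot_scaleDl.

Fact quot_scaleAl (c : k) (x y : quotAlg) : c *: (x * y) = (c *: x) * y.
Proof.
rewrite /GRing.mul /GRing.scale /=.
by elim/quotP: x => ?; elim/quotP: y => ?; rewrite !quotE fp_scaleAl.
Qed.
Fact quot_scaleAr (c : k) (x y : quotAlg) : c *: (x * y) = x * (c *: y).
Proof.
rewrite /GRing.mul /GRing.scale /=.
by elim/quotP: x => ?; elim/quotP: y => ?; rewrite !quotE fp_scaleAr.
Qed.

Fact toQuot_linear : linear toQuot.
Proof. by move=> c x y; rewrite -quot_addE -quot_scaleE. Qed.
HB.instance Definition _ := GRing.isLinear.Build k T quotAlg *:%R toQuot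
  toQuot_linear.
Fact toQuot_monoid_morphism : monoid_morphism toQuot.
Proof. by split=> // x y; rewrite -quot_mulE. Qed.
HB.instance Definition _ := GRing.isMonoidMorphism.Build T quotAlg toQuot
  toQuot_monoid_morphism.

End IdealQuotient.

(* The tensor product of k-modules: formal sums of pairs modulo bilinearity.
   Negatives and multiples by scalars act on the first components. *)
Section Tensor.
Variables (k : comNzRingType) (M N : lmodType k).
Local Notation fsum := (seq (M * N)).
Local Reserved Notation "s =! t" (at level 70, no associativity).

Inductive tenseq : fsum -> fsum -> Prop :=
  | tens_refl s : s =! s
  | tens_sym s t : s =! t -> t =! s
  | tens_trans s t u : s =! t -> t =! u -> s =! u
  | tens_cat s s' t t' : s =! s' -> t =! t' -> s ++ t =! s' ++ t'
  | tens_catC s t : s ++ t =! t ++ s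
  | tens_Dl m m' n : [:: (m + m', n)] =! [:: (m, n); (m', n)]
  | tens_Dr m n n' : [:: (m, n + n')] =! [:: (m, n); (m, n')]
  | tens_Z (c : k) m n : [:: (c *: m, n)] =! [:: (m, c *: n)]
  | tens_0 n : [:: (0, n)] =! [::]
where "s =! t" := (tenseq s t).

Definition tenseqb (s t : fsum) : bool := `[< tenseq s t >].

Lemma tenseqb_refl : reflexive tenseqb.
Proof. by move=> x; apply/asboolP; apply: tens_refl. Qed.
Lemma tenseqb_sym : symmetric tenseqb.
Proof. by move=> x y; apply/asboolP/asboolP; apply: tens_sym. Qed.
Lemma tenseqb_trans : transitive tenseqb.
Proof.
by move=> y x z /asboolP h /asboolP h'; apply/asboolP; apply: tens_trans h h'.
Qed.
Canonical tens_equiv :=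
  EquivRel tenseqb tenseqb_refl tenseqb_sym tenseqb_trans.

Definition tensor := {eq_quot tenseqb}.
HB.instance Definition _ := Choice.on tensor.
HB.instance Definition _ := EqQuotient.on tensor.

Definition tpi (s : fsum) : tensor := \pi_tensor s.

Lemma tpi_eq s t : tpi s = tpi t <-> tenseq s t.
Proof. by split=> [/eqmodP /asboolP|/asboolP h]; last apply/eqmodP. Qed.
Lemma tpiK (x : tensor) : tpi (repr x) = x.
Proof. exact: reprK. Qed.
Lemma tpi_repr s : tenseq (repr (tpi s)) s.
Proof. by apply/tpi_eq; rewrite tpiK. Qed.

Let tpiP (P : tensor -> Prop) : (forall x, P (tpi x)) -> forall x, P x.
Proof. by move=> h x; rewrite -[x]tpiK. Qed.

Definition scale_fsum (c : k) (s : fsum) : fsum :=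
  [seq (c *: p.1, p.2) | p <- s].

Lemma scale_fsum_eq c s t : tenseq s t ->
  tenseq (scale_fsum c s) (scale_fsum c t).
Proof.
elim=> {s t}.
- by move=> s; apply: tens_refl.
- by move=> s t _; apply: tens_sym.
- by move=> s t u _ h _; apply: tens_trans h.
- by move=> s s' t t' _ h _ h'; rewrite /scale_fsum !map_cat; apply: tens_cat.
- by move=> s t; rewrite /scale_fsum !map_cat; apply: tens_catC.
- by move=> m m' n; rewrite /= scalerDr; apply: tens_Dl.
- by move=> m n n' /=; apply: tens_Dr.
- by move=> a m n /=; rewrite scalerA mulrC -scalerA; apply: tens_Z.
- by move=> n; rewrite /= scaler0; apply: tens_0.
Qed.

Definition tens_add (x y : tensor) := tpi (repr x ++ repr y).
Definition tens_scale (c : k) (x : tensor) := tpi (scale_fsum c (repr x)).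
Definition tens_opp := tens_scale (-1).

Lemma tens_addE s t : tens_add (tpi s) (tpi t) = tpi (s ++ t).
Proof. by apply/tpi_eq/tens_cat; apply: tpi_repr. Qed.
Lemma tens_scaleE c s : tens_scale c (tpi s) = tpi (scale_fsum c s).
Proof. exact/tpi_eq/scale_fsum_eq/tpi_repr. Qed.

Let tensE := (tens_addE, tens_scaleE).

Fact tens_addA : associative tens_add.
Proof. by do 3!elim/tpiP=> ?; rewrite !tensE catA. Qed.
Fact tens_addC : commutative tens_add.
Proof. by do 2!elim/tpiP=> ?; rewrite !tensE; apply/tpi_eq/tens_catC. Qed.
Fact tens_add0 : left_id (tpi [::]) tens_add.
Proof. by elim/tpiP=> ?; rewrite !tensE. Qed.

Fact tens_scaleDl x a b :
  tens_scale (a + b) x = tens_add (tens_scale a x) (tens_scale b x).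
Proof.
elim/tpiP: x => s; rewrite !tens_scaleE.
elim: s => [|[m n] s IHs] /=; first by rewrite tens_addE.
have consE p t : tpi (p :: t) = tens_add (tpi [:: p]) (tpi t).
  by rewrite tens_addE.
rewrite consE IHs scalerDl.
have -> : tpi [:: (a *: m + b *: m, n)] =
    tens_add (tpi [:: (a *: m, n)]) (tpi [:: (b *: m, n)]).
  by rewrite tens_addE; apply/tpi_eq/tens_Dl.
rewrite [tpi (_ :: scale_fsum a s)]consE [tpi (_ :: scale_fsum b s)]consE.
rewrite -!tens_addA; congr tens_add.
by rewrite tens_addA [RHS]tens_addA; congr tens_add; apply: tens_addC.
Qed.

Fact tens_scale0 x : tens_scale 0 x = tpi [::].
Proof.
elim/tpiP: x => s; rewrite tensE.
elim: s => [//|[m n] s IHs] /=; rewrite scale0r -cat1s -tens_addE IHs.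
by rewrite tens_addE; apply/tpi_eq/tens_0.
Qed.

Fact tens_scale1 : left_id 1 tens_scale.
Proof.
elim/tpiP=> s; rewrite tensE; congr tpi.
by elim: s => //= -[m n] s ->; rewrite scale1r.
Qed.

Fact tens_addN : left_inverse (tpi [::]) tens_opp tens_add.
Proof.
move=> x; rewrite -[X in tens_add _ X]tens_scale1 -tens_scaleDl.
by rewrite addNr tens_scale0.
Qed.
HB.instance Definition _ := GRing.isZmodule.Build tensor
  tens_addA tens_addC tens_add0 tens_addN.

Fact tens_scaleA a b x : tens_scale a (tens_scale b x) = tens_scale (a * b) x.
Proof.
elim/tpiP: x => s; rewrite !tensE /scale_fsum -map_comp; congr tpi.
by apply: eq_map => p /=; rewrite scalerA.
Qed.
Fact tens_scaleDr : right_distributive tens_scale +%R.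
Proof.
move=> c; do 2!elim/tpiP=> ?; rewrite /GRing.add /= !tensE.
by rewrite /scale_fsum map_cat.
Qed.
HB.instance Definition _ := GRing.Zmodule_isLmodule.Build k tensor
  tens_scaleA tens_scale1 tens_scaleDr (fun x a b => tens_scaleDl x a b).

Definition tmul (m : M) (n : N) : tensor := tpi [:: (m, n)].

Lemma tpiE s : tpi s = \sum_(p <- s) tmul p.1 p.2.
Proof.
elim: s => [|[m n] s IHs]; first by rewrite big_nil.
by rewrite big_cons -IHs -cat1s -tens_addE.
Qed.

Lemma tensor_sum (x : tensor) : x = \sum_(p <- repr x) tmul p.1 p.2.
Proof. by rewrite -tpiE tpiK. Qed.

Lemma tensor_ind (P : tensor -> Prop) :
  P 0 -> (forall m n x, P x -> P (tmul m n + x)) -> forall x, P x.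
Proof.
move=> P0 PD x; rewrite [x]tensor_sum; elim: (repr x) => [|p s IHs].
  by rewrite big_nil.
by rewrite big_cons; apply: PD.
Qed.

Lemma tmulDl m m' n : tmul (m + m') n = tmul m n + tmul m' n.
Proof. by rewrite [RHS]tens_addE; apply/tpi_eq/tens_Dl. Qed.
Lemma tmulDr m n n' : tmul m (n + n') = tmul m n + tmul m n'.
Proof. by rewrite [RHS]tens_addE; apply/tpi_eq/tens_Dr. Qed.
Lemma tmulZl (c : k) m n : tmul (c *: m) n = c *: tmul m n.
Proof. by rewrite [RHS]tens_scaleE. Qed.
Lemma tmulZr (c : k) m n : tmul m (c *: n) = c *: tmul m n.
Proof. by rewrite -tmulZl; apply/tpi_eq/tens_sym/tens_Z. Qed.
Lemma tmul0l n : tmul 0 n = 0.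
Proof. exact/tpi_eq/tens_0. Qed.
Lemma tmulNl m n : tmul (- m) n = - tmul m n.
Proof. by rewrite -scaleN1r tmulZl scaleN1r. Qed.
Lemma tmulNr m n : tmul m (- n) = - tmul m n.
Proof. by rewrite -scaleN1r tmulZr scaleN1r. Qed.
Lemma tmul0r m : tmul m 0 = 0.
Proof. by rewrite -(scale0r 0) tmulZr scale0r. Qed.
Lemma tmulBl m m' n : tmul (m - m') n = tmul m n - tmul m' n.
Proof. by rewrite tmulDl tmulNl. Qed.
Lemma tmulBr m n n' : tmul m (n - n') = tmul m n - tmul m n'.
Proof. by rewrite tmulDr tmulNr. Qed.

Definition bilin (V : lmodType k) (B : M -> N -> V) :=
  (forall n, linear (B^~ n)) /\ (forall m, linear (B m)).

Lemma tmul_bilin : bilin tmul.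
Proof.
split=> [n c m m'|m c n n'].
  by rewrite tmulDl tmulZl.
by rewrite tmulDr tmulZr.
Qed.

(* The linear map on the tensor product induced by B; it is meaningful only
   for bilinear B. *)
Definition tlift (V : lmodType k) (B : M -> N -> V) (x : tensor) : V :=
  \sum_(p <- repr x) B p.1 p.2.

Section Lift.
Variables (V : lmodType k) (B : M -> N -> V) (hB : bilin B).

Lemma bilinDl m m' n : B (m + m') n = B m n + B m' n.
Proof. by have := hB.1 n 1 m m'; rewrite !scale1r. Qed.
Lemma bilinDr m n n' : B m (n + n') = B m n + B m n'.
Proof. by have := hB.2 m 1 n n'; rewrite !scale1r. Qed.
Lemma bilin0l n : B 0 n = 0.
Proof. by apply: (addrI (B 0 n)); rewrite -bilinDl !addr0. Qed.
Lemma bilin0r m : B m 0 = 0.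
Proof. by apply: (addrI (B m 0)); rewrite -bilinDr !addr0. Qed.
Lemma bilinZl (c : k) m n : B (c *: m) n = c *: B m n.
Proof. by have := hB.1 n c m 0; rewrite bilin0l !addr0. Qed.
Lemma bilinZr (c : k) m n : B m (c *: n) = c *: B m n.
Proof. by have := hB.2 m c n 0; rewrite bilin0r !addr0. Qed.

Lemma tlift_eq s t : tenseq s t ->
  \sum_(p <- s) B p.1 p.2 = \sum_(p <- t) B p.1 p.2.
Proof.
elim=> {s t} //.
- by move=> s t u _ -> _ ->.
- by move=> s s' t t' _ h _ h'; rewrite !big_cat /= h h'.
- by move=> s t; rewrite !big_cat /= addrC.
- by move=> m m' n; rewrite !big_cons !big_nil /= !addr0 bilinDl.
- by move=> m n n'; rewrite !big_cons !big_nil /= !addr0 bilinDr.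
- by move=> c m n; rewrite !big_seq1 /= bilinZl bilinZr.
- by move=> n; rewrite big_seq1 big_nil /= bilin0l.
Qed.

Lemma tliftE_pi s : tlift B (tpi s) = \sum_(p <- s) B p.1 p.2.
Proof. exact/tlift_eq/tpi_repr. Qed.

Lemma tliftE m n : tlift B (tmul m n) = B m n.
Proof. by rewrite tliftE_pi big_seq1. Qed.

Lemma tlift_linear : linear (tlift B).
Proof.
move=> c; do 2!elim/tpiP=> ?.
rewrite [_ *: _]tens_scaleE [_ + _]tens_addE !tliftE_pi big_cat /=.
congr (_ + _); rewrite scaler_sumr big_map /=.
by apply: eq_bigr => p _; rewrite bilinZl.
Qed.

End Lift.
End Tensor.

Arguments tmul {k M N} m n.
Notation "x ⊗ y" := (tmul x y) (at level 40, left associativity) : ring_scope.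

Section TensorAlgebra.
Variables (k : comNzRingType) (A : comAlgType k).
Local Notation T := (tensor A A).

Definition talg_mul (x y : T) : T :=
  tlift (fun a b => tlift (fun c e => (a * c) ⊗ (b * e)) y) x.

Lemma talg_mul_bilin1 (a b : A) :
  bilin (fun c e : A => (a * c) ⊗ (b * e) : T).
Proof.
split=> [e|c] r x y.
  by rewrite mulrDr tmulDl -scalerAr tmulZl.
by rewrite mulrDr tmulDr -scalerAr tmulZr.
Qed.

Lemma talg_mul_bilin2 (y : T) :
  bilin (fun a b : A => tlift (fun c e => (a * c) ⊗ (b * e)) y).
Proof.
split=> [b|a] r u v; rewrite /tlift scaler_sumr -big_split /=;
  apply: eq_bigr => p _.
  by rewrite mulrDl tmulDl -scalerAl tmulZl.
by rewrite mulrDl tmulDr -scalerAl tmulZr.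
Qed.

Lemma talg_mulE a b c e : talg_mul (a ⊗ b) (c ⊗ e) = (a * c) ⊗ (b * e).
Proof.
rewrite /talg_mul tliftE; last exact: talg_mul_bilin2.
by rewrite tliftE //; apply: talg_mul_bilin1.
Qed.

Fact talg_mulDl : left_distributive talg_mul +%R.
Proof.
move=> x y z; have := tlift_linear (talg_mul_bilin2 z) 1 x y.
by rewrite !scale1r.
Qed.

Fact talg_mulDr : right_distributive talg_mul +%R.
Proof.
move=> x y z; rewrite /talg_mul /tlift -big_split /=; apply: eq_bigr => p _.
by have := tlift_linear (talg_mul_bilin1 p.1 p.2) 1 y z; rewrite !scale1r.
Qed.

Let talg_mul0l x : talg_mul 0 x = 0.
Proof. by apply: (addrI (talg_mul 0 x)); rewrite -talg_mulDl !addr0. Qed.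
Let talg_mul0r x : talg_mul x 0 = 0.
Proof. by apply: (addrI (talg_mul x 0)); rewrite -talg_mulDr !addr0. Qed.

Fact talg_mulC : commutative talg_mul.
Proof.
elim/tensor_ind=> [|a b x IHx] y; first by rewrite talg_mul0l talg_mul0r.
rewrite talg_mulDl talg_mulDr IHx; congr (_ + _).
elim/tensor_ind: y => [|c e y IHy]; first by rewrite talg_mul0l talg_mul0r.
by rewrite talg_mulDl talg_mulDr IHy !talg_mulE mulrC [e * b]mulrC.
Qed.

Fact talg_mulA : associative talg_mul.
Proof.
elim/tensor_ind=> [|a b x IHx] y z; first by rewrite !talg_mul0l.
rewrite !talg_mulDl IHx {IHx}; congr (_ + _).
elim/tensor_ind: y => [|c e y IHy]; first by rewrite talg_mul0l !talg_mul0r talg_mul0l.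
rewrite !(talg_mulDl, talg_mulDr) IHy {IHy}; congr (_ + _).
elim/tensor_ind: z => [|u v z IHz]; first by rewrite !talg_mul0r.
by rewrite !talg_mulDr IHz !talg_mulE !mulrA.
Qed.

Fact talg_mul1 : left_id (1 ⊗ 1) talg_mul.
Proof.
elim/tensor_ind=> [|a b x IHx]; first exact: talg_mul0r.
by rewrite talg_mulDr IHx talg_mulE !mul1r.
Qed.

Fact talg_1neq0 : (1 ⊗ 1 : T) != 0.
Proof.
have hB : bilin (fun a b : A => a * b).
  split=> [b|a] r u v; first by rewrite mulrDl -scalerAl.
  by rewrite mulrDr -scalerAr.
apply/eqP => /(congr1 (tlift (fun a b : A => a * b))).
rewrite tliftE // mulr1 -[0 : T](tmul0l A (0 : A)) tliftE // mul0r.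
exact/eqP/oner_neq0.
Qed.

HB.instance Definition _ := GRing.Zmodule_isComNzRing.Build T
  talg_mulA talg_mulC talg_mul1 talg_mulDl talg_1neq0.

Lemma tensM (a b c e : A) : (a ⊗ b) * (c ⊗ e) = (a * c) ⊗ (b * e) :> T.
Proof. exact: talg_mulE. Qed.

Fact talg_scaleAl (r : k) (x y : T) : r *: (x * y) = (r *: x) * y.
Proof.
elim/tensor_ind: x => [|a b x IHx]; first by rewrite !(mul0r, scaler0).
rewrite mulrDl !scalerDr mulrDl IHx {IHx}; congr (_ + _).
elim/tensor_ind: y => [|c e y IHy]; first by rewrite !(mulr0, scaler0).
by rewrite !mulrDr scalerDr IHy -!tmulZl !tensM -tmulZl scalerAl.
Qed.
HB.instance Definition _ := GRing.Lmodule_isLalgebra.Build k T talg_scaleAl.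
HB.instance Definition _ := GRing.Lalgebra_isComAlgebra.Build k T.

End TensorAlgebra.

(* The free integro-differential algebra A ⊗_K A over (A, d, J), in the
   ordinary case K = ker d = k. *)
Section FreeIntegroDifferential.
Variables (k : comNzRingType) (A : comAlgType k).
Variables d J : {linear A -> A}.
Local Notation T := (tensor A A).

Definition tder : T -> T := tlift (fun a b => d a ⊗ b).
Definition tint : T -> T := tlift (fun a b => J a ⊗ b - 1 ⊗ (b * J a)).

Lemma tder_bilin : bilin (fun a b : A => d a ⊗ b : T).
Proof.
split=> [b|a] r u v; first by rewrite linearP tmulDl tmulZl.
by rewrite tmulDr tmulZr.
Qed.

Lemma tint_bilin : bilin (fun a b : A => J a ⊗ b - 1 ⊗ (b * J a) : T).
Proof.
split=> [b|a] r u v; rewrite scalerBr addrACA -opprD.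
  by rewrite linearP mulrDr -scalerAr tmulDl tmulDr tmulZl tmulZr.
by rewrite mulrDl -scalerAl !tmulDr !tmulZr.
Qed.

HB.instance Definition _ := GRing.isLinear.Build k T T *:%R tder
  (tlift_linear tder_bilin).
HB.instance Definition _ := GRing.isLinear.Build k T T *:%R tint
  (tlift_linear tint_bilin).

Lemma tderE a b : tder (a ⊗ b) = d a ⊗ b.
Proof. exact: (tliftE tder_bilin). Qed.

Lemma tintE a b : tint (a ⊗ b) = J a ⊗ b - 1 ⊗ (b * J a).
Proof. exact: (tliftE tint_bilin). Qed.

End FreeIntegroDifferential.

Lemma tensor_biadd_ext (k : comNzRingType) (M N : lmodType k) (V : zmodType)
    (f g : tensor M N -> tensor M N -> V) :
  (forall y, {morph f^~ y : x x' / x + x'}) ->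
  (forall x, {morph f x : y y' / y + y'}) ->
  (forall y, {morph g^~ y : x x' / x + x'}) ->
  (forall x, {morph g x : y y' / y + y'}) ->
  (forall m n m' n', f (m ⊗ n) (m' ⊗ n') = g (m ⊗ n) (m' ⊗ n')) ->
  forall x y, f x y = g x y.
Proof.
move=> fDl fDr gDl gDr fg x y.
have f0 z : f 0 z = 0 by apply: (addrI (f 0 z)); rewrite -fDl !addr0.
have g0 z : g 0 z = 0 by apply: (addrI (g 0 z)); rewrite -gDl !addr0.
have f0r z : f z 0 = 0 by apply: (addrI (f z 0)); rewrite -fDr !addr0.
have g0r z : g z 0 = 0 by apply: (addrI (g z 0)); rewrite -gDr !addr0.
elim/tensor_ind: x => [|m n x IHx]; first by rewrite f0 g0.
rewrite fDl gDl IHx {IHx}; congr (_ + _).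
elim/tensor_ind: y => [|m' n' y IHy]; first by rewrite f0r g0r.
by rewrite fDr gDr IHy fg.
Qed.

Lemma free_integro_differential (k : comNzRingType) (lam : k)
    (A : comAlgType k) (d J : {linear A -> A}) :
  differential_Rota_Baxter lam d J -> ordinary d ->
  integro_differential lam (tder d) (tint J).
Proof.
move=> [dM _ dJ] dker.
have d1 : d 1 = 0 by apply/dker; exists 1; rewrite scale1r.
have tintd v w : tint J (d v ⊗ w) = v ⊗ w - 1 ⊗ (w * v).
  have [|c hc] := (dker (v - J (d v))).1; first by rewrite raddfB /= dJ subrr.
  have -> : tint J (d v ⊗ w) = J (d v) ⊗ w - 1 ⊗ (w * J (d v)).
    exact: tintE.
  have -> : J (d v) = v - c *: 1 by rewrite -hc opprB addrC subrK.
  rewrite mulrBr tmulBl tmulBr -scalerAr mulr1 tmulZl tmulZr.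
  by rewrite opprB addrA subrK.
have add3 (V : zmodType) (x1 x2 y1 y2 z1 z2 : V) :
    x1 + x2 + (y1 + y2) + (z1 + z2) = x1 + y1 + z1 + (x2 + y2 + z2).
  by rewrite [RHS]addrACA [X in _ = X + _]addrACA.
split.
- apply: tensor_biadd_ext.
  + by move=> y x x'; rewrite mulrDl raddfD.
  + by move=> x y y'; rewrite mulrDr raddfD.
  + move=> y x x'; rewrite !raddfD /= !mulrDl scalerDr.
    exact: add3.
  + move=> x y y'; rewrite !raddfD /= !mulrDr scalerDr.
    exact: add3.
  + move=> a b c e; rewrite !tderE !tensM tderE dM.
    by rewrite -tmulZl !tmulDl.
- apply: tensor_biadd_ext.
  + by move=> y x x'; rewrite mulrDl.
  + by move=> x y y'; rewrite raddfD /= mulrDr.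
  + move=> y x x'; rewrite !raddfD /= !mulrDl !raddfD /= ?scalerDr.
    exact: add3.
  + move=> x y y'; rewrite raddfD /= !mulrDr !raddfD /= ?scalerDr.
    exact: add3.
  + move=> a b c e.
    rewrite !tintE tderE !mulrBr !tensM raddfB /= mulr1.
    have -> : d a * J c = d (a * J c) - lam *: (d a * c) - a * c.
      by rewrite dM dJ !addrK.
    rewrite !tmulBl !raddfB /= !tmulZl linearZ /= !tintd.
    rewrite !mulrA !mulr1 tintd [b * e * _ * a]mulrAC.
    set q := lam *: _; set r := 1 ⊗ _; set s := a ⊗ _.
    set t := tint J _; rewrite -!addrA opprB; congr (_ + _).
    rewrite [RHS]addrC -!addrA; symmetry.
    rewrite [- s + (t + _)]addrCA [r + (t + _)]addrCA addKr.
    rewrite [- s + (q + _)]addrCA [r + (q + _)]addrCA addKr.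
    by rewrite addrCA subrr addr0.
- move=> x; elim/tensor_ind: x => [|a b x IHx]; first by rewrite !raddf0.
  rewrite !raddfD /= IHx tintE raddfB /= !tderE dJ d1.
  by rewrite tmul0l subr0.
Qed.

Inductive opsym := symD | symI.

Section OperatorRings.
Variables (k : comNzRingType) (lam : k) (A : comAlgType k).
Variables d J : A -> A.
Local Notation P := (freeProd A opsym).
Local Notation "[ f ]" := (fpcoef opsym f : P).
Local Notation D := (fpsym A symD : P).
Local Notation I := (fpsym A symI : P).

Inductive drb_relator : P -> Prop :=
  | drb_der f :
      drb_relator (D * [f] - [f] * D - lam *: ([d f] * D) - [d f])
  | drb_int f :
      drb_relator (I * [f] * I - [J f] * I + I * [J f] + lam *: (I * [f]))
  | drb_section : drb_relator (D * I - 1).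

Definition evaluation (f : A) : A := f - J (d f).

Inductive id_relator : P -> Prop :=
  | id_der f :
      id_relator (D * [f] - [f] * D - lam *: ([d f] * D) - [d f])
  | id_section : id_relator (D * I - 1)
  | id_int f :
      id_relator (I * [f + lam *: d f] * D - [f] + I * [d f]
                  + [evaluation f] * (1 - I * D)).

(* F[∂,∮] and F[∂,∫], respectively *)
Definition drb_operators := quotAlg drb_relator.
Definition id_operators := quotAlg id_relator.

End OperatorRings.

Section Generators.
Variables (k : comNzRingType) (A : algType k).
Variable S : freeProd A opsym -> Prop.

Definition opcoef (f : A) : quotAlg S := toQuot S (fpcoef opsym f).
Definition opD : quotAlg S := toQuot S (fpsym A symD).
Definition opI : quotAlg S := toQuot S (fpsym A symI).

End Generators.

Arguments opcoef {k A S} f.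
Arguments opD {k A S}.
Arguments opI {k A S}.

Definition operator_assignment (k : comNzRingType) (lam : k) (A : comAlgType k)
    (d J : {linear A -> A})
    (phi : drb_operators lam d J -> id_operators lam (tder d) (tint J)) :=
  [/\ forall (f : A) (n : nat),
        phi (opcoef f * opD ^+ n) = opcoef (f ⊗ 1) * opD ^+ n,
      forall f g : A,
        phi (opcoef f * opI * opcoef g) =
        opcoef (f ⊗ 1) * opI * opcoef (g ⊗ 1)
    & forall (f g : A) (n : nat), (0 < n)%N ->
        phi (opcoef f * opI * opcoef g * opD ^+ n) =
        opcoef (f ⊗ 1) * opI * opcoef (g ⊗ 1) * opD ^+ n].

(* Main.v *)
Require Import Defs.
From HB Require Import structures.
From mathcomp Require Import all_boot all_order all_algebra.
From mathcomp Require Import boolp.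

Set Implicit Arguments.
Unset Strict Implicit.
Unset Printing Implicit Defensive.

Import GRing.Theory.
Local Open Scope ring_scope.

(** Write F~ for the tensor square of F. Three facts carry the proof.

    Existence. It is enough that the operators of F~ satisfy the relations
    defining the operator ring of F. Only the Rota-Baxter relation for the
    coefficient f ⊗ 1 is not immediate. In any ring of integro-differential
    operators, multiplying the relation for ∫(h + λh')∂ by ∫ on the right, with
    h = ∫f, gives the Rota-Baxter relation ∫f∫ = h∫ - ∫h - λ∫f
    ([id_opI_coef_opI]). In F~ the integral h of f ⊗ 1 is
    (∮f) ⊗ 1 - 1 ⊗ (∮f), and its second term, being a constant, commutes with ∫
    ([id_opI_const]), so it cancels from h∫ - ∫h ([id_rota_baxter]).

    Uniqueness. The operators f∂^n and f∮g∂^n span the operator ring of F, since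
    their span contains 1 and is stable under left multiplication by f, ∂ and ∮
    ([drb_normal]).

    Injectivity. F~ is a module over its own ring of integro-differential
    operators ([id_operators_act]). Write an operator of F in Horner form
    f + ι(t) + x∂, where t in F ⊗ F stands for a sum of operators a∮b. If its
    image vanishes, let it act on 1: as ∂ kills 1, there remains
    f ⊗ 1 + Σ(a(∮b) ⊗ 1 - a ⊗ ∮b) = 0, where ∮b is now an element of F. The map
    id ⊗ ∂ kills everything of the form z ⊗ 1 and turns the rest into -t; hence
    t = 0, then f = 0. Now the image of x∂ vanishes, and ∂∫ = 1 shows that so
    does the image of x: induction on the Horner form concludes ([operator_hom_eq0]). *)

(** * The ring of additive endomorphisms *)

Section AdditiveEndomorphisms.
Variable V : zmodType.

Record endo := Endo {endo_fun :> V -> V; endoD : {morph endo_fun : x y / x + y}}.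

HB.instance Definition _ := gen_eqMixin endo.
HB.instance Definition _ := gen_choiceMixin endo.

Lemma endoP (f g : endo) : f =1 g -> f = g.
Proof.
case: f g => [f fD] [g gD] /= /funext fg; rewrite -fg in gD *.
by congr Endo; apply: Prop_irrelevance.
Qed.

Lemma endo0 (f : endo) : f 0 = 0.
Proof. by apply: (addrI (f 0)); rewrite -endoD !addr0. Qed.

Fact zero_endoD : {morph (fun=> 0) : x y / x + y : V}.
Proof. by move=> x y; rewrite addr0. Qed.
Fact add_endoD (f g : endo) : {morph (fun x => f x + g x) : x y / x + y}.
Proof. by move=> x y; rewrite !endoD addrACA. Qed.
Fact opp_endoD (f : endo) : {morph (fun x => - f x) : x y / x + y}.
Proof. by move=> x y; rewrite endoD opprD. Qed.
Fact one_endoD : {morph id : x y / x + y : V}.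
Proof. by []. Qed.
Fact mul_endoD (f g : endo) : {morph f \o g : x y / x + y}.
Proof. by move=> x y /=; rewrite !endoD. Qed.

Definition add_endo f g := Endo (add_endoD f g).
Definition mul_endo f g := Endo (mul_endoD f g).

Fact add_endoA : associative add_endo.
Proof. by move=> f g h; apply: endoP => x /=; rewrite addrA. Qed.
Fact add_endoC : commutative add_endo.
Proof. by move=> f g; apply: endoP => x /=; rewrite addrC. Qed.
Fact add_endo0 : left_id (Endo zero_endoD) add_endo.
Proof. by move=> f; apply: endoP => x /=; rewrite add0r. Qed.
Fact add_endoN : left_inverse (Endo zero_endoD) (fun f => Endo (opp_endoD f)) add_endo.
Proof. by move=> f; apply: endoP => x /=; rewrite addNr. Qed.
HB.instance Definition _ := GRing.isZmodule.Build endo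
  add_endoA add_endoC add_endo0 add_endoN.

Fact mul_endoA : associative mul_endo.
Proof. by move=> f g h; apply: endoP. Qed.
Fact mul_endo1l : left_id (Endo one_endoD) mul_endo.
Proof. by move=> f; apply: endoP. Qed.
Fact mul_endo1r : right_id (Endo one_endoD) mul_endo.
Proof. by move=> f; apply: endoP. Qed.
Fact mul_endoDl : left_distributive mul_endo +%R.
Proof. by move=> f g h; apply: endoP. Qed.
Fact mul_endoDr : right_distributive mul_endo +%R.
Proof. by move=> f g h; apply: endoP => x /=; rewrite endoD. Qed.
HB.instance Definition _ := GRing.Zmodule_isPzRing.Build endo
  mul_endoA mul_endo1l mul_endo1r mul_endoDl mul_endoDr.

End AdditiveEndomorphisms.

(** * Rings presented by generators and relators *)

Section Quotient.
Variables (k : comNzRingType) (A : algType k) (S : freeProd A opsym -> Prop).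
Variables (B : pzRingType) (h : {rmorphism A -> B}) (D I : B).
Hypothesis hD : forall c : k, h (c *: 1) * D = D * h (c *: 1).
Hypothesis hI : forall c : k, h (c *: 1) * I = I * h (c *: 1).

(** The values of a homomorphism on the generators determine it on the free
    product, so quantifying over all [phi] with the prescribed values is only a
    way to evaluate the relators without naming the induced map. *)
Lemma quotAlg_universal :
  (forall phi : {rmorphism freeProd A opsym -> B},
     (forall a, phi (fpcoef opsym a) = h a) ->
     phi (fpsym A symD) = D -> phi (fpsym A symI) = I ->
     forall x, S x -> phi x = 0) ->
  exists phi : {rmorphism quotAlg S -> B},
    [/\ forall a, phi (opcoef a) = h a, phi opD = D & phi opI = I].
Proof.
pose s o := if o is symD then D else I.
have hs (c : k) o : h (c *: 1) * s o = s o * h (c *: 1) by case: o.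
case: (freeProd_universal hs) => phi [phiC phis].
move=> /(_ phi phiC (phis symD) (phis symI)) phiS.
have phi_ideal x : ideal_gen S x -> phi x = 0.
  elim=> [y /phiS //||y z _ y0 _ z0|a y b _ y0]; first exact: rmorph0.
    by rewrite rmorphD y0 z0 addr0.
  by rewrite !rmorphM y0 mulr0 mul0r.
pose psi (x : quotAlg S) := phi (repr x).
have psiE x : psi (toQuot S x) = phi x.
  by apply/eqP; rewrite -subr_eq0 -rmorphB; apply/eqP/phi_ideal/repr_ideal.
have quotP (P : quotAlg S -> Prop) : (forall x, P (toQuot S x)) -> forall x, P x.
  by move=> Pq x; rewrite -[x]reprKQ.
have psi0 : psi 0 = 0 by rewrite -[0](rmorph0 (toQuot S)) psiE rmorph0.
have psiD : {morph psi : x y / x + y}.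
  by do 2!elim/quotP=> ?; rewrite -rmorphD !psiE rmorphD.
have psiM : monoid_morphism psi.
  split; first by rewrite -[1](rmorph1 (toQuot S)) psiE rmorph1.
  by do 2!elim/quotP=> ?; rewrite -rmorphM !psiE rmorphM.
pose LD := GRing.isNmodMorphism.Build _ _ psi (psi0, psiD).
pose LM := GRing.isMonoidMorphism.Build _ _ psi psiM.
exists (HB.pack_for {rmorphism quotAlg S -> B} psi LD LM).
by split=> [a||]; rewrite [LHS]psiE.
Qed.

End Quotient.

Section OperatorRing.
Variables (k : comNzRingType) (A : algType k) (S : freeProd A opsym -> Prop).
Local Notation Q := (quotAlg S).

Lemma opcoef_linear : linear (@opcoef k A S).
Proof. by move=> c a b; rewrite /opcoef !linearP. Qed.
HB.instance Definition _ := GRing.isLinear.Build k A Q *:%R (@opcoef k A S)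
  opcoef_linear.
Lemma opcoef_monoid_morphism : monoid_morphism (@opcoef k A S).
Proof. by split=> [|a b]; rewrite /opcoef ?rmorph1 ?rmorphM. Qed.
HB.instance Definition _ := GRing.isMonoidMorphism.Build A Q (@opcoef k A S)
  opcoef_monoid_morphism.

Lemma opscaleE (c : k) (x : Q) : c *: x = opcoef (c *: 1) * x.
Proof. by rewrite linearZ /= rmorph1 -quot_scaleAl mul1r. Qed.

Lemma opcoef_central (c : k) (x : Q) : opcoef (c *: 1) * x = x * opcoef (c *: 1).
Proof. by rewrite linearZ /= rmorph1 -quot_scaleAl -quot_scaleAr mul1r mulr1. Qed.

Lemma toQuot_rel (x : freeProd A opsym) : S x -> toQuot S x = 0.
Proof.
by move=> Sx; rewrite -[0](rmorph0 (toQuot S)) toQuot_eq subr0; apply: ideal_rel.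
Qed.

(** Every element is reached from 1 by left multiplications by generators and by
    sums; a property stable under these is easier to verify than one that must
    be shown for products of arbitrary elements. *)
Lemma quotAlg_ind (P : Q -> Prop) :
  (forall a x, P x -> P (opcoef a * x)) -> (forall x, P x -> P (opD * x)) ->
  (forall x, P x -> P (opI * x)) -> (forall x y, P x -> P y -> P (x + y)) ->
  P 1 -> forall x, P x.
Proof.
move=> PC PD PI Padd P1 x.
suff PM (z : freeProd A opsym) y : P y -> P (toQuot S z * y).
  by rewrite -[x]reprKQ -[toQuot _ _]mulr1; apply: PM.
elim/freeProd_ind: z y => [a|[]|z1 z2 IH1 IH2|z1 z2 IH1 IH2] y Py.
- exact: PC.
- exact: PD.
- exact: PI.
- by rewrite rmorphD mulrDl; apply: Padd; [apply: IH1|apply: IH2].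
- by rewrite rmorphM -mulrA; apply/IH1/IH2.
Qed.

End OperatorRing.

(** * Relations between operators *)

Section Relations.
Variables (k : comNzRingType) (lam : k) (A : comAlgType k).
Variables (d J : A -> A).

Section Derivation.
Variable S : freeProd A opsym -> Prop.
Local Notation "[ f ]" := (opcoef f : quotAlg S).
Local Notation D := (opD : quotAlg S).
Local Notation I := (opI : quotAlg S).

Lemma opD_coef f :
    S (fpsym A symD * fpcoef opsym f - fpcoef opsym f * fpsym A symD
       - lam *: (fpcoef opsym (d f) * fpsym A symD) - fpcoef opsym (d f)) ->
  D * [f] = [f] * D + lam *: ([d f] * D) + [d f].
Proof.
move=> /toQuot_rel; rewrite !linearB linearZ !rmorphM /= => h.
by apply/eqP; rewrite -subr_eq0 !opprD !addrA; apply/eqP.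
Qed.

Lemma opD_opI : S (fpsym A symD * fpsym A symI - 1) -> D * I = 1.
Proof. by move=> /toQuot_rel; rewrite rmorphB rmorphM rmorph1 => /subr0_eq. Qed.

End Derivation.

Lemma drb_opI_coef_opI f (I : drb_operators lam d J := opI) :
  I * opcoef f * I = opcoef (J f) * I - I * opcoef (J f) - lam *: (I * opcoef f).
Proof.
have /toQuot_rel := @drb_int _ lam _ d J f.
rewrite !linearD linearN linearZ !rmorphM /= => h.
by apply/eqP; rewrite -subr_eq0 !(opprD, opprK) !addrA; apply/eqP.
Qed.

Local Notation R := (id_operators lam d J).
Local Notation "[ f ]" := (opcoef f : R).
Local Notation D := (opD : R).
Local Notation I := (opI : R).

Lemma id_opI_coef_opD f :
  I * [f + lam *: d f] * D =
  [f] - I * [d f] - [evaluation d J f] * (1 - I * D).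
Proof.
have /toQuot_rel := @id_int _ lam _ d J f.
rewrite !(raddfD (toQuot _)) !(raddfN (toQuot _)) /= !rmorphM /=.
rewrite (raddfB (toQuot _)) /= rmorphM rmorph1 /=.
move=> h; apply/eqP; rewrite -subr_eq0 !(opprD, opprK) !addrA.
exact/eqP.
Qed.

(** For a constant c the evaluation at c is c itself, so the integration by parts
    relation reduces to ∫c∂ = c∫∂; multiply by ∫ on the right. *)
Lemma id_opI_const c : d c = 0 -> J 0 = 0 -> I * [c] = [c] * I.
Proof.
move=> dc J0; have DI : D * I = 1 by apply/opD_opI/id_section.
have := congr1 ( *%R^~ I) (id_opI_coef_opD c).
rewrite /evaluation dc scaler0 J0 addr0 subr0 raddf0 mulr0 subr0.
rewrite -[LHS]mulrA DI mulr1 => ->.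
by rewrite mulrBl -mulrA mulrBl mul1r -mulrA DI mulr1 subrr mulr0 subr0.
Qed.

(** The integral of f has evaluation zero, so integration by parts for it reads
    ∫(Jf + λf)∂ = Jf - ∫f; multiply by ∫ on the right. *)
Lemma id_opI_coef_opI f : d (J f) = f ->
  I * [f] * I = [J f] * I - I * [J f] - lam *: (I * [f]).
Proof.
move=> dJ; have DI : D * I = 1 by apply/opD_opI/id_section.
have := congr1 ( *%R^~ I) (id_opI_coef_opD (J f)).
rewrite /evaluation dJ subrr raddf0 mul0r subr0 -[LHS]mulrA DI mulr1.
rewrite raddfD /= mulrDr linearZ /= -quot_scaleAr mulrBl => h.
by rewrite -[RHS]addrA -opprD h subKr.
Qed.

End Relations.

(** * The action on an integro-differential algebra *)

Section Action.
Variables (k : comNzRingType) (lam : k) (A : comAlgType k).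
Variables (d J : {linear A -> A}).
Hypothesis ID : integro_differential lam d J.

Lemma id_operators_act : exists rho : {rmorphism id_operators lam d J -> endo A},
  [/\ forall a x, rho (opcoef a) x = a * x, forall x, rho opD x = d x &
      forall x, rho opI x = J x].
Proof.
have [dM JM dJ] := ID.
have J_const u g : d u = 0 -> u * J g = J (u * g).
  by move=> du; rewrite JM du !mul0r raddf0 scaler0 addr0 add0r.
have mulD (a : A) : {morph *%R a : x y / x + y} by move=> x y; rewrite mulrDr.
pose m a := Endo (@mulD a).
have mB : {morph m : x y / x - y}.
  by move=> a b; apply: endoP => x /=; rewrite mulrBl.
have mM : monoid_morphism m.
  by split=> [|a b]; apply: endoP => x /=; rewrite ?mul1r ?mulrA.
pose LB := GRing.isZmodMorphism.Build _ _ m mB.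
pose LM := GRing.isMonoidMorphism.Build _ _ m mM.
pose h := HB.pack_for {rmorphism A -> endo A} m LB LM.
have linE (f : {linear A -> A}) : {morph f : x y / x + y} by exact: raddfD.
have hC (f : {linear A -> A}) (c : k) :
    h (c *: 1) * Endo (linE f) = Endo (linE f) * h (c *: 1).
  by apply: endoP => x /=; rewrite -!scalerAl !mul1r linearZ.
case: (quotAlg_universal (S := id_relator lam d J) (hC d) (hC J))
    => [|rho [rhoC rhoD rhoI]].
  move=> phi phiC phiD phiI _ []=> [f||f]; apply: endoP => x.
  - rewrite fp_scaleAl -linearZ !rmorphB !rmorphM /= !phiC phiD /=.
    by rewrite dM scalerAl (addrAC (d f * x + _)) addrK addrK subrr.
  - by rewrite rmorphB rmorphM phiD phiI rmorph1 /= dJ subrr.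
  - rewrite !(rmorphB, rmorphD, rmorphM) /= !phiC phiD phiI rmorph1 /=.
    (* Split x as J (d x) plus the constant x - J (d x): the weighted
       integration by parts handles the first summand, and constants move
       through J. *)
    have du : d (x - J (d x)) = 0 by rewrite raddfB /= dJ subrr.
    rewrite -scalerAl (raddfD J) /= (linearZ_LR J) /= [J (d f) * _]mulrC (J_const _ _ du).
    have -> : J (f * d x) + lam *: J (d f * d x) = f * J (d x) - J (d f * J (d x)).
      by rewrite JM -[X in _ = X - _]addrA [RHS]addrC addKr.
    rewrite [(_ - _) * d f]mulrC !mulrBr raddfB /= opprB.
    set a := f * J _; set b := J (d f * J _); set c := f * x; set e := J (d f * x).
    rewrite [a - b - c]addrAC addrACA [a - c + _]addrC addrA.
    by rewrite -[c - a]opprB addrK [- b + e]addrC -[b - e]opprB subrr.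
exists rho; split=> [a x|x|x]; first by rewrite rhoC.
  by rewrite rhoD.
by rewrite rhoI.
Qed.

End Action.

(** * Normal forms of differential Rota-Baxter operators *)

Section NormalForms.
Variables (k : comNzRingType) (lam : k) (A : comAlgType k).
Variables d J : A -> A.
Local Notation Q := (drb_operators lam d J).
Local Notation "[ f ]" := (opcoef f : Q).
Local Notation D := (opD : Q).
Local Notation I := (opI : Q).

Definition integral_operator (S : freeProd A opsym -> Prop) : tensor A A -> quotAlg S :=
  tlift (fun f g => opcoef f * opI * opcoef g).

Lemma integral_operator_bilin S :
  bilin (fun f g : A => opcoef f * opI * opcoef g : quotAlg S).
Proof.
split=> [g|f] c x y; rewrite linearP.
  by rewrite !mulrDl !quot_scaleAl.
by rewrite mulrDr -quot_scaleAr.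
Qed.

HB.instance Definition _ S := GRing.isLinear.Build k (tensor A A) (quotAlg S) *:%R
  (@integral_operator S) (tlift_linear (integral_operator_bilin S)).

Local Notation ι := (@integral_operator (drb_relator lam d J)).

Lemma integral_operatorE S f g :
  integral_operator S (f ⊗ g) = opcoef f * opI * opcoef g.
Proof. exact: (tliftE (integral_operator_bilin S)). Qed.

(** Horner form in powers of ∂ on the right: normal forms of different degrees
    add without padding, and an induction step isolates the part of degree zero. *)
Inductive normal : Q -> Prop :=
  | normal0 : normal 0
  | normal_step f t x : normal x -> normal ([f] + ι t + x * D).

Lemma normalD x y : normal x -> normal y -> normal (x + y).
Proof.
move=> nx; elim: nx y => [|f t {}x nx IHx] y ny; first by rewrite add0r.
case: ny => [|g u y' ny]; first by rewrite addr0; apply: normal_step.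
rewrite addrACA [_ + ι t + _]addrACA -mulrDl -(raddfD ι) -(raddfD opcoef).
exact/normal_step/IHx.
Qed.

Lemma normal_coef f : normal [f].
Proof. by have := normal_step f 0 normal0; rewrite raddf0 mul0r !addr0. Qed.

Lemma normal_integral t : normal (ι t).
Proof. by have := normal_step 0 t normal0; rewrite raddf0 mul0r addr0 add0r. Qed.

Lemma normal_mulD x : normal x -> normal (x * D).
Proof. by move=> /(normal_step 0 0); rewrite !raddf0 !add0r. Qed.

Lemma normal_sum (h : tensor A A -> Q) : {morph h : t u / t + u} ->
  (forall f g, normal (h (f ⊗ g))) -> forall t, normal (h t).
Proof.
move=> hD hn; elim/tensor_ind=> [|f g t IHt]; last first.
  by rewrite hD; apply: normalD.
suff -> : h 0 = 0 by apply: normal0.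
by apply: (addrI (h 0)); rewrite -hD !addr0.
Qed.

(** Powers of ∂ sit on the right, where left multiplication does not reach them:
    only the part of degree zero has to be checked. *)
Lemma normal_mull z : (forall f, normal (z * [f])) ->
  (forall f g, normal (z * ([f] * I * [g]))) -> forall x, normal x -> normal (z * x).
Proof.
move=> zf zI x; elim=> [|f t {}x _ IHx]; first by rewrite mulr0; apply: normal0.
rewrite !mulrDr mulrA; apply: normalD; last exact: normal_mulD.
apply: normalD; first exact: zf.
apply: (normal_sum (h := fun t => z * ι t)) => [u v|g h].
  by rewrite raddfD mulrDr.
by rewrite integral_operatorE; apply: zI.
Qed.

Lemma normal_opI_coef f g : normal ([f] * I * [g]).
Proof. by rewrite -integral_operatorE; apply: normal_integral. Qed.

(** The relators are rewriting rules that push ∂ to the right of coefficients,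
    cancel ∂∮ and remove nested integrals; ∮∂ is already in normal form. *)
Lemma drb_normal x : normal x.
Proof.
have opDE f : D * [f] = [f] * D + lam *: ([d f] * D) + [d f].
  exact/opD_coef/drb_der.
have DI : D * I = 1 by apply/opD_opI/drb_section.
have scaleE (c : k) y : normal y -> normal (c *: y).
  move=> ny; rewrite opscaleE; apply: normal_mull ny => [f|f g].
    by rewrite -(rmorphM opcoef); apply: normal_coef.
  by rewrite !mulrA -(rmorphM opcoef); apply: normal_opI_coef.
have opIE f : normal (I * [f]).
  by have := normal_opI_coef 1 f; rewrite rmorph1 mul1r.
elim/quotAlg_ind: x => [a x|x|x|x y|]; last 1 [exact: normal_coef 1].
- apply: normal_mull => [f|f g]; first by rewrite -(rmorphM opcoef); apply: normal_coef.
  by rewrite !mulrA -(rmorphM opcoef); apply: normal_opI_coef.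
- apply: normal_mull => [f|f g].
    rewrite opDE; apply/normalD/normal_coef; apply: normalD.
      exact/normal_mulD/normal_coef.
    exact/scaleE/normal_mulD/normal_coef.
  rewrite !mulrA opDE !mulrDl -!quot_scaleAl -![_ * D * I]mulrA DI !mulr1.
  rewrite -!(rmorphM opcoef).
  apply/normalD/normal_opI_coef; apply: normalD; first exact: normal_coef.
  exact/scaleE/normal_coef.
- apply: normal_mull => [|f g]; first exact: opIE.
  rewrite !mulrA drb_opI_coef_opI -scaleN1r -scaleNr !mulrDl -!quot_scaleAl.
  rewrite -!mulrA -!(rmorphM opcoef) !mulrA.
  apply: normalD; last exact/scaleE/opIE.
  by apply: normalD; [exact: normal_opI_coef|exact/scaleE/opIE].
- exact: normalD.
Qed.

Lemma drb_operator_eq (V : lmodType k) (phi psi : {linear Q -> V}) :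
  (forall f n, phi (opcoef f * opD ^+ n) = psi (opcoef f * opD ^+ n)) ->
  (forall f g n, phi (opcoef f * opI * opcoef g * opD ^+ n) =
                 psi (opcoef f * opI * opcoef g * opD ^+ n)) ->
  phi =1 psi.
Proof.
move=> eqC eqI x; rewrite -[x]mulr1 -(expr0 opD).
elim: (drb_normal x) 0%N => [|f t {}x _ IHx] n; first by rewrite mul0r !raddf0.
rewrite !mulrDl !raddfD /= eqC -mulrA -exprS IHx; congr (_ + _ + _).
elim/tensor_ind: t => [|g h t IHt]; first by rewrite raddf0 mul0r !raddf0.
by rewrite raddfD /= integral_operatorE mulrDl !raddfD /= eqI IHt.
Qed.

End NormalForms.

(** * The embedding *)

Section Embedding.
Variables (k : comNzRingType) (lam : k) (A : comAlgType k).
Variables d J : {linear A -> A}.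
Hypothesis drb : differential_Rota_Baxter lam d J.
Hypothesis d_ord : ordinary d.
Local Notation T := (tensor A A).
Local Notation Q := (drb_operators lam d J).
Local Notation R := (id_operators lam (tder d) (tint J)).
Local Notation ι := (@integral_operator k A (drb_relator lam d J)).

Definition left_factor (f : A) : T := f ⊗ 1.

Lemma left_factor_zmod : {morph left_factor : f g / f - g}.
Proof. by move=> f g; apply: tmulBl. Qed.
HB.instance Definition _ := GRing.isZmodMorphism.Build A T left_factor
  left_factor_zmod.
Lemma left_factor_monoid : monoid_morphism left_factor.
Proof. by split=> // f g; rewrite /left_factor tensM mulr1. Qed.
HB.instance Definition _ := GRing.isMonoidMorphism.Build A T left_factor
  left_factor_monoid.

Lemma ordinary_der1 : d 1 = 0.
Proof. by apply/d_ord; exists 1; rewrite scale1r. Qed.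

(** The integral of f ⊗ 1 differs from (∮f) ⊗ 1 by the constant 1 ⊗ (∮f), which
    commutes with ∫ and hence cancels between the first two terms. *)
Lemma id_rota_baxter f (I : R := opI) :
  I * opcoef (f ⊗ 1) * I =
  opcoef (J f ⊗ 1) * I - I * opcoef (J f ⊗ 1) - lam *: (I * opcoef (f ⊗ 1)).
Proof.
have [_ _ tdJ] := free_integro_differential drb d_ord.
have dc : tder d (1 ⊗ J f) = 0 by rewrite tderE ordinary_der1 tmul0l.
have cI := id_opI_const lam dc (raddf0 (tint J)).
rewrite (id_opI_coef_opI lam (tdJ _)) tintE mul1r raddfB /= mulrBl mulrBr cI.
by rewrite opprB addrA subrK.
Qed.

Lemma drb_to_id : exists psi : {rmorphism Q -> R},
  [/\ forall f, psi (opcoef f) = opcoef (f ⊗ 1), psi opD = opD &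
      psi opI = opI].
Proof.
pose h : {rmorphism A -> R} := opcoef \o left_factor.
have hC (c : k) (x : R) : h (c *: 1) * x = x * h (c *: 1).
  by rewrite /= /left_factor tmulZl opcoef_central.
have opDE f := @opD_coef _ lam _ _ (id_relator lam (tder d) (tint J)) (f ⊗ 1)
  (id_der _ _ _ _).
apply: (quotAlg_universal (h := h)) => // phi phiC phiD phiI _ [f|f|].
- rewrite fp_scaleAl -linearZ !rmorphB !rmorphM /= !phiC phiD /=.
  rewrite /left_factor opDE tmulZl linearZ /= -quot_scaleAl tderE.
  set u := opcoef _ * _; set v := lam *: _; set w := opcoef _.
  by apply/eqP; rewrite !subr_eq add0r [w + v]addrC [X in _ == X]addrC addrA.
- rewrite fp_scaleAr -linearZ.
  rewrite !(rmorphB, rmorphD, rmorphM) /= !phiC phiI /=.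
  rewrite /left_factor tmulZl linearZ /= -quot_scaleAr id_rota_baxter.
  set p := opcoef _ * _; set q := _ * opcoef (J f ⊗ 1); set l := lam *: _.
  by rewrite (addrAC p) (addrAC (p - l)) subrK (addrAC p) subrr add0r addNr.
by rewrite rmorphB rmorphM rmorph1 phiD phiI opD_opI ?subrr //; apply: id_section.
Qed.

(** Differentiation in the factor of constants recovers t from what is left when
    its operator acts on 1. *)
Definition right_der : T -> T := tlift (fun a b => a ⊗ d b).

Lemma right_der_bilin : bilin (fun a b : A => a ⊗ d b : T).
Proof.
split=> [b|a] c u v; first by rewrite tmulDl tmulZl.
by rewrite linearP tmulDr tmulZr.
Qed.

HB.instance Definition _ := GRing.isLinear.Build k T T *:%R right_der
  (tlift_linear right_der_bilin).

Lemma right_derE a b : right_der (a ⊗ b) = a ⊗ d b.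
Proof. exact: (tliftE right_der_bilin). Qed.

(** The multiplication of the algebra is a retraction. *)
Lemma left_factor_inj : injective left_factor.
Proof.
have mul_bilin : bilin (fun a b : A => a * b).
  split=> [b|a] c u v; first by rewrite mulrDl -scalerAl.
  by rewrite mulrDr -scalerAr.
by move=> f g /(congr1 (tlift (fun a b => a * b))); rewrite !tliftE // !mulr1.
Qed.

(** Acting on 1 detects the part of degree zero, because ∂ kills 1; multiplying
    by ∫ on the right then lowers the degree of what remains. *)
Lemma operator_hom_eq0 (psi : {rmorphism Q -> R}) :
  (forall f, psi (opcoef f) = opcoef (f ⊗ 1)) -> psi opD = opD ->
  psi opI = opI -> forall x, psi x = 0 -> x = 0.
Proof.
move=> psiC psiD psiI x; have [_ _ dJ] := drb.
have [rho [rhoC rhoD rhoI]] :=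
  id_operators_act (free_integro_differential drb d_ord).
pose act y : T := rho (psi y) 1.
have actD y z : act (y + z) = act y + act z by rewrite /act !rmorphD.
have act_eq0 y : psi y = 0 -> act y = 0 by rewrite /act => ->; rewrite rmorph0.
have act_coef f : act (opcoef f) = f ⊗ 1.
  by rewrite /act psiC rhoC mulr1.
have act_opD y : act (y * opD) = 0.
  rewrite /act rmorphM psiD rmorphM /= rhoD /= tderE ordinary_der1 tmul0l.
  exact: endo0.
have act_integral u : right_der (act (ι u)) = - u.
  elim/tensor_ind: u => [|a b u IHu]; first by rewrite /act !raddf0.
  rewrite raddfD actD raddfD /= IHu opprD; congr (_ + _).
  rewrite /act integral_operatorE !rmorphM /= !psiC psiI !(rhoC, rhoI) /=.
  rewrite [X in tint _ X]mulr1 tintE mulrBr !tensM !mul1r !mulr1 raddfB /=.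
  by rewrite !right_derE dJ ordinary_der1 tmul0r sub0r.
elim: (drb_normal x) => // f t {}x _ IHx psi0.
have act0 : f ⊗ 1 + act (ι t) = 0.
  by rewrite -act_coef -actD -[LHS]addr0 -[X in _ + X](act_opD x) -actD act_eq0.
(* [right_der] sees only the terms a ⊗ ∮b, and ∂∮ = 1 turns them back into t. *)
have t0 : t = 0.
  apply/oppr_inj; rewrite oppr0 -act_integral -[act _](addKr (f ⊗ 1)) act0 addr0.
  by rewrite raddfN /= right_derE ordinary_der1 tmul0r oppr0.
have f0 : f = 0.
  apply: left_factor_inj; rewrite [RHS]raddf0 -[LHS]addr0.
  by rewrite -[RHS]act0 t0 raddf0 act_eq0 // rmorph0.
have DI : opD * opI = 1 :> R by apply/opD_opI/id_section.
move: psi0; rewrite t0 f0 !raddf0 !add0r rmorphM psiD => psi0.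
by rewrite IHx ?mul0r // -[psi x]mulr1 -DI mulrA psi0 mul0r.
Qed.

End Embedding.

Theorem theorem4p8 (k : comNzRingType) (lam : k) (F : comAlgType k)
    (d J : {linear F -> F}) :
  differential_Rota_Baxter lam d J ->
  ordinary d ->
  exists psi : {linear drb_operators lam d J ->
                       id_operators lam (tder d) (tint J)},
    [/\ operator_assignment psi,
        forall phi : {linear drb_operators lam d J ->
                             id_operators lam (tder d) (tint J)},
          operator_assignment phi -> phi =1 psi,
        monoid_morphism psi
      & injective psi].
Proof.
move=> drb d_ord; case: (drb_to_id drb d_ord) => psi [psiC psiD psiI].
have psi_linear : linear psi.
  move=> c x y; rewrite rmorphD opscaleE rmorphM psiC tmulZl /=.
  by rewrite -[opcoef _ * psi x]opscaleE.
pose L := GRing.isLinear.Build _ _ _ _ psi psi_linear.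
pose psiL := HB.pack_for {linear drb_operators lam d J ->
  id_operators lam (tder d) (tint J)} (psi : _ -> _) L.
exists psiL.
have psi_assign : operator_assignment psi.
  by split=> [f n|f g|f g n _]; rewrite !rmorphM ?rmorphXn /= !psiC ?psiI ?psiD.
split=> //=.
- move=> phi [phi1 phi2 phi3]; have [psi1 psi2 psi3] := psi_assign.
  apply: (drb_operator_eq (psi := psiL)) => [f n|f g [|n]] /=; first by rewrite phi1 psi1.
    by rewrite !mulr1 phi2 psi2.
  by rewrite phi3 ?psi3.
- by split; [exact: rmorph1|exact: rmorphM].
- move=> x y /eqP; rewrite -subr_eq0 -rmorphB => /eqP psi0.
  by apply/eqP; rewrite -subr_eq0; apply/eqP; exact: operator_hom_eq0 psi0.
Qed.
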